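(* Let $\{(y_{i0}, y_{i1}, D_i)\}_{i=1}^n$ be an i.i.d. panel sample, where $D_i$ is a real-valued running variable and, for $t \in \{0,1\}$, the outcome satisfies $$y_{it} = f_t(D_i) + \gamma(D_i)\,\mathbf{1}(D_i \geq 0) + \tau(D_i)\,\mathbf{1}(D_i \geq 0)\,\mathbf{1}(t=1) + \varepsilon_{it},$$ with $f_0, f_1, \gamma, \tau : \mathbb{R} \to \mathbb{R}$ (measurable) functions and $\varepsilon_{it}$ real random variables. Assume: (i) the functions $f_0$, $f_1$ and $\tau$ are continuous at $D = 0$; (ii) for each $t \in \{0,1\}$, the function $D \mapsto \mathbb{E}[\varepsilon_{it} \mid D_i = D]$ is continuous at $D = 0$. Then the one-sided limits below exist and $$\tau(0) = \lim_{D \to 0^+} \mathbb{E}[y_{i1} - y_{i0} \mid D_i = D] \;-\; \lim_{D \to 0^-} \mathbb{E}[y_{i1} - y_{i0} \mid D_i = D].$$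
   Context: Units $i \in \{1,\dots,n\}$ are observed in two periods, $t = 0$ (before treatment) and $t = 1$ (after treatment). The running variable $D_i$ is the signed distance of unit $i$ to the border of a treated area, normalized so that the border is at $0$ and positive values lie inside the treated area; it does not depend on $t$. The function $f_t$ is the untreated location-specific component in period $t$; $\gamma$ is a time-invariant discontinuity term at the cutoff, on which no continuity is assumed; $\tau$ is the treatment effect as a function of distance; and $\varepsilon_{it}$ is the individual-specific component. Since the sample is i.i.d., the conditional expectations do not depend on $i$. Convention for conditional expectations: $\mathbb{E}[\,\cdot \mid D_i = D]$ denotes integration against a fixed regular conditional distribution $P(\cdot \mid D_i = D)$ of the underlying random variables given $D_i$. For every $D$ in a neighbourhood of $0$, this distribution is concentrated on the event $\{D_i = D\}$, and $\varepsilon_{i0}, \varepsilon_{i1}$ are integrable under it, so that the conditional expectations are well-defined functions of $D$ near $0$. *)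

(* Defs.v *)
(* MathComp-Analysis, over an abstract R : realType. *)
From HB Require Import structures.
From mathcomp Require Import all_boot all_order all_algebra.
From mathcomp Require Import all_classical all_reals all_analysis.

Set Implicit Arguments.
Unset Strict Implicit.
Unset Printing Implicit Defensive.

Import Order.TTheory GRing.Theory Num.Theory.
Import numFieldNormedType.Exports.

Local Open Scope classical_set_scope.
Local Open Scope ring_scope.

Definition mutually_independent d d' (T : measurableType d)
    (T' : measurableType d') (R : realType) (P : probability T R)
    (I : finType) (X : I -> T -> T') : Prop :=
  forall (J : {set I}) (B : I -> set T'), (forall i, measurable (B i)) ->
    P (\bigcap_(i in [set` J]) (X i @^-1` B i)) =
    (\prod_(i in J) P (X i @^-1` B i))%E.

Definition identically_distributed d d' (T : measurableType d)
    (T' : measurableType d') (R : realType) (P : probability T R)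
    (I : finType) (X : I -> T -> T') : Prop :=
  forall (i j : I) (B : set T'), measurable B ->
    P (X i @^-1` B) = P (X j @^-1` B).

Definition iid d d' (T : measurableType d) (T' : measurableType d')
    (R : realType) (P : probability T R) (I : finType)
    (X : I -> T -> T') : Prop :=
  mutually_independent P X /\ identically_distributed P X.

(* [kappa x] plays the role of P( . | X = x): the kernel disintegrates P along
   the law of X.  This determines [kappa] only up to a null set of the law
   of X, and it does not by itself force [kappa x] to live on {X = x}. *)
Definition regular_conditional_distribution d (T : measurableType d)
    (R : realType) (P : probability T R) (X : {RV P >-> R})
    (kappa : R.-pker R ~> T) : Prop :=
  forall (A : set R) (B : set T), measurable A -> measurable B ->
    P (X @^-1` A `&` B) = (\int[distribution P X]_(x in A) kappa x B)%E.

(* E[Y | X = x] for the version [kappa]; real-valued, hence meaningful only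
   where Y is integrable under [kappa x]. *)
Definition cond_exp d (T : measurableType d) (R : realType)
    (kappa : R.-pker R ~> T) (Y : T -> R) (x : R) : R :=
  \int[kappa x]_w Y w.

(* Main.v *)
(* On {D_i = x} the term gamma cancels in y_i1 - y_i0, which is therefore a
   constant plus eps_i1 - eps_i0.  As P( . | D_i = x) lives on this event, for x
   near 0
     E[y_i1 - y_i0 | D_i = x] = (f_1 - f_0)(x) + tau(x) 1(x >= 0)
            + E[eps_i1 | D_i = x] - E[eps_i0 | D_i = x],
   where only the tau term may jump at 0. *)

Require Import Defs.
From HB Require Import structures.
From mathcomp Require Import all_boot all_order all_algebra.
From mathcomp Require Import all_classical all_reals all_analysis.
From mathcomp Require Import measurable_realfun ring.

Set Implicit Arguments.
Unset Strict Implicit.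
Unset Printing Implicit Defensive.

Import Order.TTheory GRing.Theory Num.Theory.
Import numFieldNormedType.Exports.

Local Open Scope classical_set_scope.
Local Open Scope ring_scope.

(** The complement of [A] is null, so [Y] may be replaced by [c + Z] under the integral, and total
    mass one makes the constant contribute exactly [c]. It is meant for [mu := kappa x] and [A] the
    fibre of [D i] over [x]. *)
Lemma Rintegral_concentrated_shift d (T : measurableType d) (R : realType)
    (mu : {measure set T -> \bar R}) (A : set T) (c : R) (Y Z : T -> R) :
  mu [set: T] = 1%E -> measurable A -> mu A = 1%E ->
  measurable_fun [set: T] Y -> mu.-integrable [set: T] (EFin \o Z) ->
  {in A, forall w, Y w = c + Z w} ->
  \int[mu]_w Y w = c + \int[mu]_w Z w.
Proof.
move=> muT mA muA mY iZ YE.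
have muAC : mu (~` A) = 0%E.
  rewrite -setTD measureD ?setTI//; last by rewrite [ltLHS]muT ltry.
  by rewrite [X in (X - _)%E]muT [X in (_ - X)%E]muA subee.
have mZ : measurable_fun [set: T] Z.
  by move/measurable_int: iZ => /measurable_EFinP.
have icst : mu.-integrable [set: T] (EFin \o cst c).
  apply/integrableP; split; first exact/measurable_EFinP.
  by rewrite /= integral_cst// muT mule1 ltry.
have -> : \int[mu]_w Y w = \int[mu]_w (c + Z w).
  rewrite /Rintegral; congr fine; apply: ae_eq_integral => //.
  - exact/measurable_EFinP.
  - by apply/measurable_EFinP; exact: measurable_funD.
  exists (~` A); split=> //; first exact: measurableC.
  move=> w /= wNE Aw; apply: wNE => _.
  by rewrite YE// inE.
by rewrite RintegralD// Rintegral_cst// muT mulr1.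
Qed.

Theorem theorem2 (R : realType) (d : measure_display) (T : measurableType d)
    (P : probability T R) (n : nat)
    (y : 'I_2 -> 'I_n -> {RV P >-> R}) (D : 'I_n -> {RV P >-> R})
    (eps : 'I_2 -> 'I_n -> {RV P >-> R})
    (f : 'I_2 -> R -> R) (gamma tau : R -> R)
    (f_meas : forall t, measurable_fun [set: R] (f t))
    (gamma_meas : measurable_fun [set: R] gamma)
    (tau_meas : measurable_fun [set: R] tau)
    (sample_iid : iid P (fun i w => (y 0 i w, y 1 i w, D i w)))
    (model : forall t i w, y t i w =
       f t (D i w) + gamma (D i w) * (0 <= D i w)%R%:R
       + tau (D i w) * (0 <= D i w)%R%:R * (t == 1)%R%:R + eps t i w)
    (i : 'I_n) (kappa : R.-pker R ~> T)
    (kappa_rcd : regular_conditional_distribution (D i) kappa)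
    (kappa_conc :
       \forall x \near (0 : R), kappa x (D i @^-1` [set x]) = 1%E)
    (eps_int : forall t, \forall x \near (0 : R),
       (kappa x).-integrable [set: T] (EFin \o eps t i))
    (f_cont : forall t, {for 0, continuous (f t)})
    (tau_cont : {for 0, continuous tau})
    (eps_cont : forall t,
       {for 0, continuous (cond_exp kappa (eps t i))}) :
  let m := cond_exp kappa (fun w => y 1 i w - y 0 i w) in
  [/\ cvg (m x @[x --> 0^'+]),
      cvg (m x @[x --> 0^'-]) &
      tau 0 = lim (m x @[x --> 0^'+]) - lim (m x @[x --> 0^'-])].
Proof.
move=> m.
(* [g] collects everything in [m] that is continuous at 0; the remainder is the [tau] term with its
   indicator. *)
pose g x := f 1 x - f 0 x + cond_exp kappa (eps 1 i) x
            - cond_exp kappa (eps 0 i) x.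
have mE : \forall x \near (0 : R), m x = g x + tau x * (0 <= x)%R%:R.
  have e0 := eps_int 0; have e1 := eps_int 1.
  near=> x.
  have ie0 : (kappa x).-integrable [set: T] (EFin \o eps 0 i) by near: x.
  have ie1 : (kappa x).-integrable [set: T] (EFin \o eps 1 i) by near: x.
  have kx : kappa x (D i @^-1` [set x]) = 1%E by near: x.
  (* The shift is the value on the fibre of [y 1 i - y 0 i] without its noise: there [D i w] is
     frozen at [x]. *)
  rewrite /m /cond_exp (@Rintegral_concentrated_shift _ _ _ _
    (D i @^-1` [set x]) (f 1 x - f 0 x + tau x * (0 <= x)%R%:R) _
    (fun w => eps 1 i w - eps 0 i w))//.
  - rewrite RintegralB// /g /cond_exp; ring.
  - exact: prob_kernel.
  - exact: measurable_funB.
  - exact: (integrableB measurableT ie1 ie0).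
  (* Both periods carry the same [gamma x] term, which cancels; the period indicator keeps [tau x]
     only from period 1. *)
  - move=> w; rewrite inE /= => Dw; rewrite !model Dw eqxx /=; ring.
have g_cvg : g x @[x --> (0 : R)] --> g 0.
  apply: cvgB; last exact: eps_cont.
  apply: cvgD; last exact: eps_cont.
  by apply: cvgB; exact: f_cont.
(* To the right of 0 the indicator is 1, so [m] agrees there with [g + tau], whose two-sided limit
   restricts to [0^'+]. *)
have cvg_r : m x @[x --> 0^'+] --> g 0 + tau 0.
  apply: cvg_trans (cvg_at_right_filter (cvgD g_cvg tau_cont)).
  apply: near_eq_cvg.
  near=> x.
  have x0 : 0 < x by near: x; exact: nbhs_right_gt.
  have -> : m x = g x + tau x * (0 <= x)%R%:R.
    by near: x; exact: cvg_within mE.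
  by rewrite ltW// mulr1.
(* To the left the indicator vanishes and [m] agrees with [g] alone, so the two limits differ by
   [tau 0]. *)
have cvg_l : m x @[x --> 0^'-] --> g 0.
  apply: cvg_trans (cvg_at_left_filter g_cvg).
  apply: near_eq_cvg.
  near=> x.
  have x0 : x < 0 by near: x; exact: nbhs_left_lt.
  have -> : m x = g x + tau x * (0 <= x)%R%:R.
    by near: x; exact: cvg_within mE.
  by rewrite leNgt x0 mulr0 addr0.
split.
- by apply/cvg_ex; exists (g 0 + tau 0).
- by apply/cvg_ex; exists (g 0).
- by rewrite (cvg_lim _ cvg_r)// (cvg_lim _ cvg_l)// addrC addKr.
Unshelve. all: by end_near.
Qed.
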